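(* Let $p\in\mathbb{R}[x_1,\dots,x_n]$. If $p$ is SOS, then $\mathrm{Proj}(p,F)$ is SOS for every face $F$ of the Newton polytope $N(p)$.
   Context: Polynomials have real coefficients. A polynomial $p\in\mathbb{R}[x_1,\dots,x_n]$ is SOS if $p=\sum_{i=1}^s q_i^2$ for some finitely many $q_1,\dots,q_s\in\mathbb{R}[x_1,\dots,x_n]$. Let $\mathbb{Z}_+$ denote the set of non-negative integers. For $p=\sum_{\alpha} c_\alpha x^\alpha$ the support $S(p)\subseteq\mathbb{Z}_+^n$ is the set of exponent vectors $\alpha$ with $c_\alpha\neq 0$ (so $S(0)=\emptyset$), and the Newton polytope is $N(p)=\mathrm{conv}(S(p))\subseteq\mathbb{R}^n$. For $T\subseteq\mathbb{R}^n$, $\mathrm{Proj}(p,T)$ is the polynomial obtained from $p$ by deleting all terms $c_\alpha x^\alpha$ with $\alpha\notin T\cap\mathbb{Z}^n$. Faces of a $d$-dimensional polytope are its faces of dimensions $0$ to $d-1$ (vertices, edges, ..., facets). *)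

(* Defs.v *)
(* MathComp; the reals are an abstract [R : realType]. *)
From HB Require Import structures.
From mathcomp Require Export all_boot all_order all_algebra.
From mathcomp Require Export boolp classical_sets reals.
From mathcomp Require Export mpoly.

Set Implicit Arguments.
Unset Strict Implicit.
Unset Printing Implicit Defensive.

Import Order.TTheory GRing.Theory Num.Theory.
Local Open Scope classical_set_scope.
Local Open Scope ring_scope.

Definition is_sos (R : realType) (n : nat) (p : {mpoly R[n]}) : Prop :=
  exists (s : nat) (q : 'I_s -> {mpoly R[n]}), p = \sum_(i < s) q i ^+ 2.

Definition exp_point (R : realType) (n : nat) (m : 'X_{1..n}) : 'rV[R]_n :=
  \row_i (m i)%:R.
Arguments exp_point R {n} m.

(* The empty family is excluded by the weights summing to 1, so the hull of
   the empty set is empty. *)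
Definition convex_hull (R : realType) (n : nat) (A : set 'rV[R]_n)
    : set 'rV[R]_n :=
  [set x | exists (k : nat) (v : 'I_k -> 'rV[R]_n) (a : 'I_k -> R),
    [/\ forall i, A (v i), forall i, 0 <= a i, \sum_i a i = 1
      & x = \sum_i a i *: v i]].

Definition newton_polytope (R : realType) (n : nat) (p : {mpoly R[n]})
    : set 'rV[R]_n :=
  convex_hull [set exp_point R m | m in [set m | m \in msupp p]].

(* Exponent vectors are integral, so keeping those whose point lies in [T] is
   the same as keeping those in the intersection of [T] with the lattice. *)
Definition mproj (R : realType) (n : nat) (p : {mpoly R[n]})
    (T : set 'rV[R]_n) : {mpoly R[n]} :=
  \sum_(m <- msupp p | exp_point R m \in T) p@_m *: 'X_[m].

Definition affinely_independent (R : realType) (n k : nat)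
    (x : 'I_k.+1 -> 'rV[R]_n) : bool :=
  row_free (\matrix_(i < k) (x (lift ord0 i) - x ord0)).

(* A nonempty set has a unique dimension; the empty set has none. *)
Definition has_dim (R : realType) (n : nat) (A : set 'rV[R]_n) (d : nat)
    : Prop :=
  (exists x : 'I_d.+1 -> 'rV[R]_n,
     (forall i, A (x i)) /\ affinely_independent x) /\
  (forall (k : nat) (x : 'I_k.+1 -> 'rV[R]_n),
     (forall i, A (x i)) -> affinely_independent x -> (k <= d)%N).

(* Faces are cut out by valid linear inequalities. The dimension condition
   leaves out the empty face and the polytope itself. *)
Definition is_face (R : realType) (n : nat) (P F : set 'rV[R]_n) : Prop :=
  (exists (c : 'rV[R]_n) (b : R),
     (forall x, P x -> \sum_i c 0 i * x 0 i <= b) /\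
     F = [set x | P x /\ \sum_i c 0 i * x 0 i = b]) /\
  (exists k d : nat, [/\ has_dim F k, has_dim P d & (k < d)%N]).

(* Main.v *)
Require Import Defs.

Set Implicit Arguments.
Unset Strict Implicit.
Unset Printing Implicit Defensive.

Import Order.TTheory GRing.Theory Num.Theory.
Local Open Scope classical_set_scope.
Local Open Scope ring_scope.

(** A face [F] of [N(p)] is where a linear form [c] attains its maximum [b] on
    [N(p)], so, giving the monomial [x^m] the weight [<c, m>], [mproj p F] is
    the part of [p] of weight [b], and all other terms of [p] have smaller
    weight.  Write [p = \sum_i q_i ^ 2].  The top-weight part is multiplicative:
    if [u] bounds the weights of [q_i], the part of weight [2 u] of [q_i ^ 2] is
    the square of the part of weight [u] of [q_i] ([mproj_hyperplane_sqr]).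

    Let [u] be the largest weight occurring in the [q_i].  The part of [p] of
    weight [2 u] is then a sum of squares that are not all zero, hence is
    nonzero, because over the reals squares cannot cancel ([sum_sqr_eq0]).  As
    [p] has no weight above [b], this forces [u <= b / 2]
    ([weight_le_half]).  Taking the part of weight [b] in [p = \sum_i q_i ^ 2]
    therefore writes [mproj p F] as the sum of the squares of the parts of
    weight [b / 2] of the [q_i]. *)

Section Projection.
Variables (R : realType) (n : nat).
Implicit Types (p q : {mpoly R[n]}) (T : set 'rV[R]_n) (m : 'X_{1..n}).

Lemma mcoeff_mproj p T m :
  (mproj p T)@_m = if exp_point R m \in T then p@_m else 0.
Proof.
rewrite /mproj big_mkcond /= raddf_sum /=.
have [mp|mp] := boolP (m \in msupp p); last first.
  rewrite (memN_msupp_eq0 mp) if_same big_seq big1 // => k kp.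
  case: ifP => _; rewrite ?mcoeff0 // mcoeffZ mcoeffX.
  by case: eqP kp => [->|_ _]; rewrite ?(negPf mp) ?mulr0.
rewrite (bigD1_seq m) ?msupp_uniq //= big1 ?addr0 => [|k km]; last first.
  by case: ifP => _; rewrite ?mcoeff0 // mcoeffZ mcoeffX (negPf km) mulr0.
by case: ifP => _; rewrite ?mcoeff0 // mcoeffZ mcoeffX eqxx mulr1.
Qed.

Lemma mproj_sum (I : finType) (q : I -> {mpoly R[n]}) T :
  mproj (\sum_i q i) T = \sum_i mproj (q i) T.
Proof.
apply/mpolyP => m; rewrite mcoeff_mproj !raddf_sum /=.
under [RHS]eq_bigr do rewrite mcoeff_mproj.
by case: ifP => // _; rewrite big1.
Qed.

Lemma mprojD p q T : mproj (p + q) T = mproj p T + mproj q T.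
Proof.
apply/mpolyP => m; rewrite mcoeffD !mcoeff_mproj mcoeffD.
by case: ifP; rewrite ?addr0.
Qed.

Lemma mproj_id p T :
  (forall m, m \in msupp p -> T (exp_point R m)) -> mproj p T = p.
Proof.
move=> pT; apply/mpolyP => m; rewrite mcoeff_mproj.
have [mp|/memN_msupp_eq0 ->] := boolP (m \in msupp p); last by rewrite if_same.
by rewrite (mem_set (pT _ mp)).
Qed.

Lemma mproj_eq0 p T :
  (forall m, m \in msupp p -> ~ T (exp_point R m)) -> mproj p T = 0.
Proof.
move=> pT; apply/mpolyP => m; rewrite mcoeff_mproj mcoeff0.
have [mp|/memN_msupp_eq0 ->] := boolP (m \in msupp p); last by rewrite if_same.
by rewrite (memNset (pT _ mp)).
Qed.

Lemma eq_mproj p T1 T2 :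
  (forall m, m \in msupp p -> T1 (exp_point R m) <-> T2 (exp_point R m)) ->
  mproj p T1 = mproj p T2.
Proof.
move=> T12; apply/mpolyP => m; rewrite !mcoeff_mproj.
have [mp|/memN_msupp_eq0 ->] := boolP (m \in msupp p); last by rewrite !if_same.
suff -> : (exp_point R m \in T1) = (exp_point R m \in T2) by [].
by apply/idP/idP; rewrite !inE => /(T12 _ mp).
Qed.

Lemma msupp_mproj p T m :
  (m \in msupp (mproj p T)) = (m \in msupp p) && (exp_point R m \in T).
Proof.
rewrite !mcoeff_msupp mcoeff_mproj; case: ifP; first by rewrite andbT.
by rewrite eqxx andbF.
Qed.

Lemma msupp_newton_polytope p m :
  m \in msupp p -> newton_polytope p (exp_point R m).
Proof.
move=> mp; exists 1%N, (fun=> exp_point R m), (fun=> 1).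
split=> [_|_||]; rewrite ?ler01 ?big_ord1 ?scale1r //.
by exists m.
Qed.

End Projection.

(** Let [M] be the largest leading monomial of the nonzero [q_i].  The
    coefficient of [x^(2 M)] in [q_i ^ 2] is the square of the coefficient of
    [x^M] in [q_i]; these squares are nonnegative reals and one of them is
    positive, so their sum does not vanish. *)
Lemma sum_sqr_eq0 (R : realType) (n : nat) (I : finType)
    (q : I -> {mpoly R[n]}) :
  \sum_i q i ^+ 2 = 0 -> forall i, q i = 0.
Proof.
move=> q0 i; apply/eqP/negPn/negP => qi0.
have [k qk0 kmax] :=
  @arg_maxP _ _ I i (fun j => q j != 0) (fun j => mlead (q j)) qi0.
pose M := mlead (q k).
have sqrE j : (q j ^+ 2)@_(M + M) = (q j)@_M ^+ 2.
  have le_jk : (mlead (q j) <= M)%O.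
    by have [->|/kmax//] := eqVneq (q j) 0; rewrite mlead0 le0x.
  by rewrite !expr2 mleadcMW.
have /eqP := congr1 (mcoeff (M + M)) q0.
rewrite raddf_sum /= mcoeff0; under eq_bigr do rewrite sqrE.
rewrite psumr_eq0 => [/allP/(_ k)|j _]; last exact: sqr_ge0.
by rewrite mem_index_enum sqrf_eq0 mleadc_eq0 (negPf qk0) => /(_ isT).
Qed.

Section Weight.
Variables (R : realType) (n : nat) (c : 'rV[R]_n).
Implicit Types (p q : {mpoly R[n]}) (u b : R) (m : 'X_{1..n}).

Definition weight m : R := \sum_i c 0 i * exp_point R m 0 i.

Definition hyperplane u : set 'rV[R]_n := [set x | \sum_i c 0 i * x 0 i = u].

Lemma weightD m1 m2 : weight (m1 + m2)%MM = weight m1 + weight m2.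
Proof.
rewrite /weight -big_split /=; apply: eq_bigr => i _.
by rewrite !mxE mnmDE natrD mulrDr.
Qed.

(** With [a] the part of weight [u] of [q], write
    [q ^ 2 = a ^ 2 + (q - a) (q + a)]: the first term has only weight [2 u],
    and the second only smaller weights, since those of [q - a] are below
    [u]. *)
Lemma mproj_hyperplane_sqr q u :
  (forall m, m \in msupp q -> weight m <= u) ->
  mproj (q ^+ 2) (hyperplane (u + u)) = mproj q (hyperplane u) ^+ 2.
Proof.
move=> qu; set a := mproj q _.
have a_u m : m \in msupp a -> weight m = u.
  by rewrite msupp_mproj => /andP[_ /set_mem].
have -> : q ^+ 2 = a ^+ 2 + (q - a) * (q + a) by rewrite -subr_sqr addrC subrK.
rewrite mprojD mproj_id => [|m]; last first.
  rewrite expr2 => /msuppM_le/allpairsP[[m1 m2] /= [m1a m2a ->]].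
  by rewrite /hyperplane /= -/(weight _) weightD !a_u.
rewrite mproj_eq0 ?addr0 // => m /msuppM_le/allpairsP[[m1 m2] /= [m1a m2a ->]].
rewrite /hyperplane /= -/(weight _) weightD => /eqP; apply/negP; rewrite lt_eqF //.
apply: ltr_leD; last first.
  by have /msuppD_le := m2a; rewrite mem_cat => /orP[/qu|/a_u ->].
have m1q : q@_m1 != 0 /\ weight m1 != u.
  move: m1a; rewrite mcoeff_msupp mcoeffB mcoeff_mproj.
  case: ifPn => [|m1u]; first by rewrite subrr eqxx.
  by rewrite subr0 => ->; split=> //; apply: contraNneq m1u; apply: mem_set.
by case: m1q => m1q m1u; rewrite lt_neqAle m1u qu // mcoeff_msupp.
Qed.

(** The largest weight [u] of the [q_i] cannot exceed [b / 2], since the part of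
    weight [2 u] of the sum of squares is a sum of squares that are not all
    zero. *)
Lemma weight_le_half (I : finType) (q : I -> {mpoly R[n]}) b :
  (forall m, m \in msupp (\sum_i q i ^+ 2) -> weight m <= b) ->
  forall i m, m \in msupp (q i) -> weight m <= b / 2.
Proof.
move=> pb.
(* Starting the maximum at [b / 2] covers the case where all [q_i] vanish. *)
pose u := \big[Num.max/b / 2]_i \big[Num.max/b / 2]_(m <- msupp (q i)) weight m.
have qu i m : m \in msupp (q i) -> weight m <= u.
  move=> mq; apply: le_trans (le_bigmax _ _ i).
  exact: le_bigmax_seq mq isT.
have [ub|bu] := leP u (b / 2) => [i m /qu mu|]; first exact: le_trans ub.
have bu2 : b < u + u by rewrite [b]splitr ltrD.
have top0 : \sum_i mproj (q i) (hyperplane u) ^+ 2 = 0.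
  under eq_bigr => i _ do rewrite -(mproj_hyperplane_sqr (qu i)).
  rewrite -mproj_sum mproj_eq0 // => m /pb mb; rewrite /hyperplane /= => mu.
  by move: mb; rewrite /weight mu leNgt bu2.
suff : u < u by rewrite ltxx.
rewrite {1}/u; apply: bigmax_lt => // i _.
rewrite big_seq; apply: bigmax_lt => // m mq.
rewrite lt_neqAle (qu i) // andbT; apply/eqP => mu.
have : m \in msupp (mproj (q i) (hyperplane u)).
  by rewrite msupp_mproj mq mem_set.
by rewrite (sum_sqr_eq0 top0) msupp0.
Qed.

End Weight.

Theorem theorem1 (R : realType) (n : nat) (p : {mpoly R[n]}) :
  is_sos p ->
  forall F : set 'rV[R]_n, is_face (newton_polytope p) F -> is_sos (mproj p F).
Proof.
move=> [s [q pE]] F [[c [b [valid ->]]] _].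
have pb m : m \in msupp p -> weight c m <= b.
  by move=> /msupp_newton_polytope; apply: valid.
have qb : forall i m, m \in msupp (q i) -> weight c m <= b / 2.
  by apply: weight_le_half; rewrite -pE.
exists s, (fun i => mproj (q i) (hyperplane c (b / 2))).
under eq_bigr => i _ do rewrite -(mproj_hyperplane_sqr (qb i)).
rewrite -splitr -mproj_sum -pE; apply: eq_mproj => m mp.
split=> [[] //|mb]; split=> //; exact: msupp_newton_polytope.
Qed.
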